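(* For any integers $r,k\ge1$, \[ \sum_{\substack{\mathrm{wt}(\mathbf{k})=r+k\\ \mathrm{dep}(\mathbf{k})=r}} \zeta^{ш}(\mathbf{k})=(-1)^{r-1}\zeta(\underbrace{1,\ldots,1}_{r-1},k+1), \] where the sum runs over all indices $\mathbf{k}=(k_1,\ldots,k_r)$ of positive integers with $k_1+\cdots+k_r=r+k$ (including those with $k_r=1$).
   Context: For an index $\mathbf{k}=(k_1,\ldots,k_r)$ of positive integers, its weight is $\mathrm{wt}(\mathbf{k})=k_1+\cdots+k_r$ and depth $\mathrm{dep}(\mathbf{k})=r$. The multiple polylogarithm is $\mathrm{Li}_{k_1,\ldots,k_r}(z)=\sum_{0<m_1<\cdots<m_r} z^{m_r}/(m_1^{k_1}\cdots m_r^{k_r})$ for $|z|<1$. When $k_r>1$, the multiple zeta value is $\zeta(k_1,\ldots,k_r)=\sum_{0<m_1<\cdots<m_r} m_1^{-k_1}\cdots m_r^{-k_r}=\mathrm{Li}_{k_1,\ldots,k_r}(1)$. The shuffle-regularized polynomial $Z^{ш}_{\mathbf{k}}(T)\in\mathbb{R}[T]$ is the unique polynomial such that $\mathrm{Li}_{k_1,\ldots,k_r}(z)=Z^{ш}_{\mathbf{k}}(-\log(1-z))+O((1-z)^{\varepsilon})$ as $z\to1^-$ for some $\varepsilon>0$; the shuffle-regularized value is $\zeta^{ш}(\mathbf{k}):=Z^{ш}_{\mathbf{k}}(0)$ (which equals $\zeta(\mathbf{k})$ when $k_r>1$). *)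

(* Defs.v *)
From mathcomp Require Export all_boot all_order all_algebra.
From mathcomp Require Export all_classical all_reals all_analysis.
Export Order.TTheory GRing.Theory Num.Theory.
Export numFieldNormedType.Exports.

Set Implicit Arguments.
Unset Strict Implicit.
Unset Printing Implicit Defensive.

Local Open Scope classical_set_scope.
Local Open Scope ring_scope.

(* An index (k_1, ..., k_r) is a sequence of positive natural numbers; it is
   stored with k_1 at the head. *)
Definition is_index (k : seq nat) : bool := all (fun i => 0 < i)%N k.

Definition wt (k : seq nat) : nat := sumn k.

Definition dep (k : seq nat) : nat := size k.

(* [path ltn 0 m] is 0 < m_1 < ... < m_r. *)
Definition incr (r N : nat) (m : r.-tuple 'I_N.+1) : bool :=
  path ltn 0%N [seq nat_of_ord i | i <- m].

Definition mdenom (R : realType) (k : seq nat) (N : nat)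
    (m : (dep k).-tuple 'I_N.+1) : R :=
  \prod_(j < dep k) (tnth m j)%:R ^+ nth 0%N k j.

(* The multiple series over 0 < m_1 < ... < m_r are limits, as N tends to
   infinity, of the finite sums over 0 < m_1 < ... < m_r <= N. *)
Definition Li_trunc (R : realType) (k : seq nat) (z : R) (N : nat) : R :=
  \sum_(m : (dep k).-tuple 'I_N.+1 | incr m)
    z ^+ last 0%N [seq nat_of_ord i | i <- m] / mdenom R m.

Definition Li (R : realType) (k : seq nat) (z : R) : R :=
  lim (Li_trunc k z N @[N --> \oo]).

Definition zeta_trunc (R : realType) (k : seq nat) (N : nat) : R :=
  \sum_(m : (dep k).-tuple 'I_N.+1 | incr m) (mdenom R m)^-1.

(* Meaningful when the last entry of k is > 1 (otherwise the limit is junk). *)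
Definition zeta (R : realType) (k : seq nat) : R :=
  lim (zeta_trunc R k N @[N --> \oo]).

Definition is_Zsh (R : realType) (k : seq nat) (P : {poly R}) : Prop :=
  exists2 eps : R, 0 < eps &
    Li k = (fun z : R => P.[- ln (1 - z)])
      +O_ (1^'-) (fun z : R => (1 - z) `^ eps).

(* The polynomial specified by [is_Zsh]; 0 is only the value [xget] would
   return if there were none. *)
Definition Zsh (R : realType) (k : seq nat) : {poly R} :=
  xget 0 [set P : {poly R} | is_Zsh k P].

Definition zeta_sh (R : realType) (k : seq nat) : R := (Zsh R k).[0].

(* Main.v *)
Require Import Defs.
From mathcomp Require Import all_boot all_order all_algebra.
From mathcomp Require Import all_classical all_reals all_analysis.
From mathcomp Require Import ring lra zify.

(* Write T = -log(1 - z). The functions Li satisfy z Li' = Li with k_r lowered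
   by one if k_r > 1, and (1 - z) Li' = Li with k_r removed if k_r = 1. Hence
   induction on the weight gives the asymptotic expansion of every Li at 1: it
   suffices that h' = O((1 - z)^(e - 1)) forces h = c + O((1 - z)^e), and c is
   the value of the series when k_r > 1. For k >= 0 comparing derivatives gives
     sum_{wt = r + k, dep = r} Li(z)
       = sum_{i = 1}^{r} T^(r - i) / (r - i)! (-1)^(i - 1) Li_{1,...,1,k+1}(z)
   with i - 1 ones on the right. For k >= 1 the functions on the right tend to
   zeta(1,...,1,k+1), so the regularized polynomial of the left-hand side is
   known; its constant term is the summand i = r. *)

Set Implicit Arguments.
Unset Strict Implicit.
Unset Printing Implicit Defensive.

Local Open Scope classical_set_scope.
Local Open Scope ring_scope.

(** * Power series with radius of convergence at least 1 *)

Section Tame.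
Context {R : realType}.
Implicit Types (c d : nat -> R) (q x z : R).

(** Bounded terms for every [q] in []0, 1[] amount to radius of convergence at least 1, and this
    form passes to derivatives and partial sums by elementary estimates. *)
Definition tame c :=
  forall q, 0 < q < 1 -> exists M, forall m, `|c m| * q ^+ m <= M.

(** Each of the powers [1, q, ..., q ^ m] is at least [q ^ m], and their sum is
    [(1 - q ^ m.+1) / (1 - q)]. *)
Lemma mulSn_expr_le q m : 0 < q < 1 -> m.+1%:R * q ^+ m <= (1 - q)^-1.
Proof.
move=> /andP[q0 q1].
suff H : m.+1%:R * q ^+ m * (1 - q) <= 1 - q ^+ m.+1.
  rewrite -[leRHS]mul1r ler_pdivlMr ?subr_gt0//; apply: le_trans H _.
  by rewrite lerBlDr lerDl exprn_ge0// ltW.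
elim: m => [|m IH]; first by rewrite expr0 expr1 !mul1r.
have h : q ^+ m.+1 <= 1 by rewrite exprn_ile1// ltW.
have h2 : q * (m.+1%:R * q ^+ m * (1 - q)) <= q * (1 - q ^+ m.+1).
  by rewrite ler_wpM2l// ltW.
have -> : m.+2%:R * q ^+ m.+1 * (1 - q) =
  q * (m.+1%:R * q ^+ m * (1 - q)) + q ^+ m.+1 * (1 - q).
  by rewrite -[m.+2]addn1 natrD [q ^+ m.+1]exprS; ring.
have h3 : (1 - q ^+ m.+1) * (1 - q) >= 0 by rewrite mulr_ge0// subr_ge0// ltW.
by rewrite [q ^+ m.+2]exprS; nra.
Qed.

Lemma sqrtr_in01 q : 0 < q < 1 -> 0 < Num.sqrt q < 1.
Proof. by move=> /andP[q0 q1]; rewrite sqrtr_gt0 q0 -sqrtr1 ltr_sqrt. Qed.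

Lemma tame_le c d : (forall m, `|d m| <= `|c m|) -> tame c -> tame d.
Proof.
move=> dc tc q q01; have [M HM] := tc q q01; exists M => m.
by apply: le_trans (HM m); rewrite ler_wpM2r// exprn_ge0//; case/andP: q01 => /ltW.
Qed.

(** With [q = s * s], one factor [s ^ m] absorbs [m.+1] and the other controls [c m]. *)
Lemma tame_mulSn c : tame c -> tame (fun m => m.+1%:R * c m).
Proof.
move=> tc q q01; have s01 := sqrtr_in01 q01; have [M HM] := tc _ s01.
have /andP[s0 s1] := s01; set s := Num.sqrt q in HM s0 s1 s01.
exists ((1 - s)^-1 * M) => m.
rewrite -(@sqr_sqrtr _ q) -/s; last by case/andP: q01 => /ltW.
rewrite normrM ger0_norm// expr2 exprMn mulrACA.
by rewrite ler_pM ?mulr_ge0// ?exprn_ge0 ?(ltW s0)// mulSn_expr_le.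
Qed.

Lemma tame_shift c : tame c -> tame (fun m => c m.+1).
Proof.
move=> tc q q01; have [M HM] := tc _ q01; have /andP[q0 _] := q01.
by exists (M / q) => m; rewrite ler_pdivlMr// -mulrA -exprSr.
Qed.

Lemma tame_diffs c : tame c -> tame (pseries_diffs c).
Proof.
move=> tc; apply: (@tame_le (fun m => m.+2%:R * c m.+1)) => [m|].
  by rewrite /pseries_diffs !normrM ler_wpM2r// !normr_nat ler_nat.
exact: tame_shift (tame_mulSn tc).
Qed.

Lemma tame_sum c : tame c -> tame (fun m => \sum_(i < m) c i).
Proof.
move=> tc q q01; have s01 := sqrtr_in01 q01; have [M HM] := tc _ s01.
have /andP[s0 s1] := s01; set s := Num.sqrt q in HM s0 s1 s01.
have M0 : 0 <= M by apply: le_trans (HM 0%N); rewrite mulr_ge0// exprn_ge0// ltW.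
exists ((1 - s)^-1 * M) => m.
rewrite -(@sqr_sqrtr _ q); last by case/andP: q01 => /ltW.
rewrite -/s expr2 exprMn mulrA.
(* As [s < 1], each term is at most [|c i| * s ^ i <= M]; the second factor [s ^ m] will absorb the
   number of terms. *)
have H : `|\sum_(i < m) c i| * s ^+ m <= m.+1%:R * M.
  apply: (@le_trans _ _ ((\sum_(i < m) `|c i|) * s ^+ m)).
    by rewrite ler_wpM2r ?exprn_ge0 ?(ltW s0)// ler_norm_sum.
  rewrite mulr_suml; apply: (@le_trans _ _ (\sum_(i < m) M)).
    apply: ler_sum => i _; apply: le_trans (HM i).
    rewrite ler_wpM2l// ler_wiXn2l ?(ltW s0) ?(ltW s1)//; exact: ltnW.
  by rewrite sumr_const card_ord -(mulr_natl M m) ler_wpM2r// ler_nat.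
apply: (@le_trans _ _ (m.+1%:R * M * s ^+ m)).
  by rewrite ler_wpM2r ?exprn_ge0 ?(ltW s0).
by rewrite mulrAC ler_wpM2r// mulSn_expr_le.
Qed.

Lemma tame_cvg c z : tame c -> `|z| < 1 -> cvgn (pseries c z).
Proof.
(* For [q] strictly between [|z|] and 1, a geometric series of ratio [|z| / q] dominates. *)
move=> tc z1; set q := (1 + `|z|) / 2.
have zq : `|z| < q by rewrite /q; have := normr_ge0 z; lra.
have q01 : 0 < q < 1 by rewrite /q; have := normr_ge0 z; lra.
have [M HM] := tc _ q01; have /andP[q0 q1] := q01.
apply: normed_cvg; apply: (@series_le_cvg _ _ (geometric M (`|z| / q))).
- by move=> n /=.
- move=> n; rewrite /geometric /= mulr_ge0 ?exprn_ge0 ?divr_ge0 ?(ltW q0)//.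
  by apply: le_trans (HM 0%N); rewrite expr0 mulr1.
- move=> n; rewrite /geometric /= normrM normrX expr_div_n mulrCA -[leLHS]mulrC.
  rewrite ler_wpM2l ?exprn_ge0// -[leLHS](@mulfK _ (q ^+ n)).
    by rewrite ler_wpM2r// invr_ge0 exprn_ge0// ltW.
  by rewrite expf_neq0// gt_eqF.
- apply: is_cvg_geometric_series.
  by rewrite normrM normr_id normfV (gtr0_norm q0) ltr_pdivrMr// mul1r.
Qed.

Definition psum c z := limn (pseries c z).

(** Termwise differentiation requires the series and its first two formal derivatives to converge at
    a point beyond [|x|]; [(1 + |x|) / 2] is one inside the disc. *)
Lemma psum_derive c x : tame c -> `|x| < 1 ->
  is_derive x 1 (psum c) (psum (pseries_diffs c) x).
Proof.
move=> tc x1; have K1 : `|(1 + `|x|) / 2| < 1.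
  by rewrite ger0_norm; have := normr_ge0 x; lra.
apply: (@pseries_snd_diffs _ _ ((1 + `|x|) / 2)).
- exact: tame_cvg.
- by apply: tame_cvg => //; exact: tame_diffs.
- by apply: tame_cvg => //; exact/tame_diffs/tame_diffs.
- by rewrite [ltRHS]ger0_norm; have := normr_ge0 x; lra.
Qed.

Lemma psumB c d z : tame c -> tame d -> `|z| < 1 ->
  psum (fun m => c m - d m) z = psum c z - psum d z.
Proof.
move=> tc td z1; rewrite /psum -limB; [|exact: tame_cvg..].
congr (limn _); apply/funext => n; rewrite /pseries /series !fctE -sumrB.
by apply: eq_bigr => i _ /=; rewrite mulrBl.
Qed.

Lemma psum_shift c z : tame c -> `|z| < 1 -> c 0%N = 0 ->
  psum c z = z * psum (fun m => c m.+1) z.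
Proof.
move=> tc z1 c0; apply/cvg_lim => //; rewrite -cvg_shiftS.
have cs : pseries (fun m => c m.+1) z @ \oo --> psum (fun m => c m.+1) z.
  exact: tame_cvg (tame_shift tc) z1.
apply: cvg_trans (cvgM (cvg_cst z) cs).
apply: near_eq_cvg; near=> n; rewrite /pseries /series /=.
rewrite [RHS]big_nat_recl// c0 mul0r add0r mulr_sumr.
by apply: eq_bigr => i _; rewrite exprS mulrCA.
Unshelve. all: by end_near. Qed.

Lemma psum0 c : psum c 0 = c 0%N.
Proof.
apply/cvg_lim => //; rewrite -cvg_shiftS; apply: cvg_near_cst; near=> n.
rewrite /pseries /series /= big_nat_recl// expr0 mulr1 big1 ?addr0// => i _.
by rewrite expr0n mulr0.
Unshelve. all: by end_near. Qed.

End Tame.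

(** * Multiple polylogarithms *)

Section Coefficients.
Context {R : realType}.
Implicit Types (w : seq nat) (x z : R).

(* For an index stored in REVERSED order, w = [:: k_r; ...; k_1], the
   coefficient of z ^ m in Li; the empty index gives Li = 1. *)
Fixpoint mcoef w (m : nat) : R :=
  match w with
  | [::] => (m == 0%N)%:R
  | j :: w' => (m%:R ^+ j)^-1 * \sum_(i < m) mcoef w' i
  end.

Definition Lr w z := psum (mcoef w) z.

Lemma mcoef_ge0 w m : 0 <= mcoef w m.
Proof.
elim: w m => [|j w IH] m /=; first exact: ler0n.
by rewrite mulr_ge0// ?invr_ge0 ?exprn_ge0// sumr_ge0.
Qed.

Lemma mcoef_cons0 j w : mcoef (j :: w) 0 = 0.
Proof. by rewrite /= big_ord0 mulr0. Qed.

Lemma tame_mcoef w : tame (mcoef w).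
Proof.
elim: w => [|j w IH].
  move=> q /andP[q0 q1]; exists 1 => m /=; rewrite normr_nat.
  case: m => [|m]; first by rewrite expr0 mulr1.
  by rewrite mul0r ler01.
apply: tame_le (tame_sum IH) => -[|m] /=; first by rewrite !big_ord0 mulr0.
rewrite normrM ger0_norm ?invr_ge0 ?exprn_ge0// ler_piMl//.
by rewrite invf_le1 ?exprn_gt0// exprn_ege1// ler1n.
Qed.

(** On coefficients, [z d/dz] is multiplication by [m]. For [j = 0] the right-hand side is a plain
    partial sum of [mcoef w]. *)
Lemma mulnr_mcoef j w m : m%:R * mcoef (j.+1 :: w) m = mcoef (j :: w) m.
Proof.
case: m => [|m]; first by rewrite !mcoef_cons0 mulr0.
by rewrite /= exprS invfM !mulrA divff ?mul1r// pnatr_eq0.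
Qed.

Lemma Lr_nil z : Lr [::] z = 1.
Proof.
apply/cvg_lim => //; rewrite -cvg_shiftS; apply: cvg_near_cst; near=> n.
rewrite /pseries /series /= big_nat_recl// expr0 mulr1 big1 ?addr0// => i _.
by rewrite mul0r.
Unshelve. all: by end_near. Qed.

Lemma Lr_cons0 j w : Lr (j :: w) 0 = 0.
Proof. by rewrite /Lr psum0 mcoef_cons0. Qed.

Lemma tame_mulnr_mcoef w : tame (fun m => m%:R * mcoef w m).
Proof.
apply: tame_le (tame_mulSn (tame_mcoef w)) => m.
by rewrite !normrM ler_wpM2r// !normr_nat ler_nat.
Qed.

Lemma Lr_diffs w z : `|z| < 1 ->
  z * psum (pseries_diffs (mcoef w)) z = psum (fun m => m%:R * mcoef w m) z.
Proof.
by move=> z1; rewrite [RHS]psum_shift ?mul0r//; exact: tame_mulnr_mcoef.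
Qed.

Lemma Lr_deriveS j w z : 0 < z < 1 ->
  is_derive z 1 (Lr (j.+2 :: w)) (z^-1 * Lr (j.+1 :: w) z).
Proof.
move=> /andP[z0 z1]; have nz : `|z| < 1 by rewrite gtr0_norm.
apply: (is_derive_eq (psum_derive (tame_mcoef _) nz)).
apply: (@mulfI _ z); first by rewrite gt_eqF.
rewrite Lr_diffs// mulrA divff ?mul1r ?gt_eqF//.
by congr (psum _ _); apply/funext => m; rewrite mulnr_mcoef.
Qed.

(** Multiplication by [1 - z] takes differences of consecutive coefficients; those of the derivative
    are partial sums of [mcoef w], so the differences telescope. *)
Lemma Lr_derive1 w z : `|z| < 1 ->
  is_derive z 1 (Lr (1%N :: w)) ((1 - z)^-1 * Lr w z).
Proof.
move=> z1; have n0 : 1 - z != 0.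
  by rewrite subr_eq0 gt_eqF// (le_lt_trans (ler_norm _)).
apply: (is_derive_eq (psum_derive (tame_mcoef _) z1)).
apply: (mulfI n0); rewrite mulrA divff// mul1r mulrBl mul1r Lr_diffs//.
rewrite -psumB//; [|exact/tame_diffs/tame_mcoef|exact: tame_mulnr_mcoef].
congr (psum _ _); apply/funext => m; rewrite /pseries_diffs !mulnr_mcoef /=.
by rewrite !expr0 !invr1 !mul1r big_ord_recr/= addrAC subrr add0r.
Qed.

End Coefficients.


(** * Asymptotic expansions at 1 *)

Section Monotone.
Context {R : realType}.
Implicit Types (f df g : R -> R) (a b x y z : R).

Lemma is_derive_continuous_within f df x y :
  (forall z, x <= z <= y -> is_derive z 1 f (df z)) ->
  {within `[x, y], continuous f}.
Proof.
move=> d; apply: derivable_within_continuous => z; rewrite in_itv /= => zxy.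
exact: (@ex_derive _ _ _ _ _ _ _ (d z zxy)).
Qed.

Lemma is_derive_ge0_le f df x y :
  (forall z, x <= z <= y -> is_derive z 1 f (df z)) ->
  (forall z, x < z < y -> 0 <= df z) -> x <= y -> f x <= f y.
Proof.
move=> d df0; rewrite le_eqVlt => /predU1P[->//|xy].
have d' z : z \in `]x, y[ -> is_derive z 1 f (df z).
  by rewrite in_itv /= => /andP[/ltW h1 /ltW h2]; apply: d; rewrite h1 h2.
have [c] := MVT xy d' (is_derive_continuous_within d).
rewrite in_itv /= => cxy E; rewrite -subr_ge0 E mulr_ge0 ?df0//.
by rewrite subr_ge0 ltW.
Qed.

(** Continuity up to the endpoints is a separate hypothesis because derivative formulas with [z^-1]
    are available only away from 0. *)
Lemma is_derive_eq0 f df x y : {within `[x, y], continuous f} ->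
  (forall z, x < z < y -> is_derive z 1 f (df z)) ->
  (forall z, x < z < y -> df z = 0) -> x <= y -> f y = f x.
Proof.
move=> cf d df0; rewrite le_eqVlt => /predU1P[->//|xy].
have d' z : z \in `]x, y[ -> is_derive z 1 f (df z).
  by rewrite in_itv /=; exact: d.
have [c] := MVT xy d' cf.
by rewrite in_itv /= => cxy /eqP; rewrite df0// mul0r subr_eq0 => /eqP.
Qed.

End Monotone.

(** * Calculus of expansions in powers of [logT] *)

Section Asymptotics.
Context {R : realType}.
Implicit Types (f g h : R -> R) (P Q : {poly R}) (e x z : R).

Definition logT z := - ln (1 - z).

Lemma logT_derive z : z < 1 -> is_derive z 1 logT (1 - z)^-1.
Proof.
move=> z1; have z0 : 0 < 1 - z by rewrite subr_gt0.
have d1 : is_derive z 1 (fun x : R => 1 - x) (0 - 1).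
  exact: (is_deriveB (is_derive_cst _ _ _) (is_derive_id _ _)).
have d2 : is_derive z 1 (@ln R \o (fun x => 1 - x)) ((1 - z)^-1 * (0 - 1)).
  by apply: is_derive1_comp; exact: is_derive1_ln.
apply: (is_derive_eq (is_deriveN d2)).
by rewrite sub0r mulrN mulr1 opprK.
Qed.

Lemma expR_logT z : z < 1 -> expR (logT z) = (1 - z)^-1.
Proof. by move=> z1; rewrite /logT expRN lnK// posrE subr_gt0. Qed.

Lemma logT_ge0 z : 0 <= z < 1 -> 0 <= logT z.
Proof. by move=> /andP[z0 z1]; rewrite /logT oppr_ge0 ln_le0//; lra. Qed.

Lemma logT_surj x : 0 <= x -> exists2 z, 0 <= z < 1 & logT z = x.
Proof.
move=> x0; exists (1 - expR (- x)).
  by have := expR_gt0 (- x); have : expR (- x) <= 1; [rewrite -expR0 ler_expR|]; lra.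
by rewrite /logT opprB addrC subrK expRK opprK.
Qed.

Lemma logT_lt x y : x < 1 -> y < 1 -> (logT x < logT y) = (x < y).
Proof.
move=> x1 y1; rewrite /logT ltrN2 ltr_ln ?posrE ?subr_gt0//.
by rewrite ltrD2l ltrN2.
Qed.

(* This is (1 - z) ^ e when z < 1. *)
Definition decay e z := expR (- (e * logT z)).

Lemma decay_gt0 e z : 0 < decay e z. Proof. exact: expR_gt0. Qed.

Lemma decay_le e e' z : 0 <= z < 1 -> e' <= e -> decay e z <= decay e' z.
Proof. by move=> z01 ee; rewrite ler_expR lerN2 ler_wpM2r// logT_ge0. Qed.

Lemma decay_derive e z : z < 1 ->
  is_derive z 1 (decay e) (- (e * decay e z / (1 - z))).
Proof.
move=> z1; have d := logT_derive z1.
have d2 : is_derive z 1 (fun z => - (e * logT z)) (- (e * (1 - z)^-1)).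
  exact: (is_deriveN (is_deriveZ _ d)).
apply: (is_derive_eq (is_derive1_comp (is_derive_expR _) d2)).
by rewrite /decay; ring.
Qed.

(** The relation of [is_Zsh] with explicit constants; [0 <= a] keeps [logT z] nonnegative wherever
    the estimate holds. *)
Definition asym f P := exists e C a,
  [/\ 0 < e, 0 <= C, 0 <= a < 1 &
      forall z, a < z < 1 -> `|f z - P.[logT z]| <= C * decay e z].

(* h - C/e (1 - z)^e increases and h + C/e (1 - z)^e decreases on ]a, 1[. *)
Lemma asym_const h (dh : R -> R) e (C a : R) : 0 < e -> 0 <= C -> 0 <= a < 1 ->
  (forall z, a < z < 1 -> is_derive z 1 h (dh z)) ->
  (forall z, a < z < 1 -> `|dh z| <= C * decay e z / (1 - z)) ->
  exists c, asym h c%:P.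
Proof.
move=> e0 C0 /andP[a0 a1] dhP dhle; set k := C / e.
have k0 : 0 <= k by rewrite divr_ge0// ltW.
have ke : k * e = C by rewrite /k divfK// gt_eqF.
have dk z : a < z < 1 ->
    is_derive z 1 (k \*: decay e) (k * (- (e * decay e z / (1 - z)))).
  by move=> /andP[_ z1]; exact: (is_deriveZ _ (decay_derive e z1)).
have uP x y : a < x -> x <= y -> y < 1 -> h x - k * decay e x <= h y - k * decay e y.
  move=> ax xy y1.
  have H z : x <= z <= y -> a < z < 1.
    by move=> /andP[h1 h2]; rewrite (lt_le_trans ax h1) (le_lt_trans h2 y1).
  apply: (@is_derive_ge0_le _ (h - k \*: decay e)
    (fun z => dh z - k * (- (e * decay e z / (1 - z))))) => //.
    by move=> z /H zz; apply: is_deriveB; [exact: dhP|exact: dk].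
  move=> z /andP[/ltW h1 /ltW h2]; have zz : a < z < 1 by apply: H; rewrite h1 h2.
  have := dhle z zz; rewrite ler_norml => /andP[h3 _].
  rewrite -ke in h3.
  by apply: le_trans (_ : 0 <= dh z + k * e * decay e z / (1 - z)) _; lra.
have vP x y : a < x -> x <= y -> y < 1 -> h y + k * decay e y <= h x + k * decay e x.
  move=> ax xy y1.
  have H z : x <= z <= y -> a < z < 1.
    by move=> /andP[h1 h2]; rewrite (lt_le_trans ax h1) (le_lt_trans h2 y1).
  rewrite -lerN2.
  apply: (@is_derive_ge0_le _ (- (h + k \*: decay e))
    (fun z => - (dh z + k * (- (e * decay e z / (1 - z)))))) => //.
    by move=> z /H zz; apply: is_deriveN; apply: is_deriveD; [exact: dhP|exact: dk].
  move=> z /andP[/ltW h1 /ltW h2]; have zz : a < z < 1 by apply: H; rewrite h1 h2.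
  have := dhle z zz; rewrite ler_norml => /andP[_ h3].
  rewrite -ke in h3.
  by apply: le_trans (_ : 0 <= - dh z + k * e * decay e z / (1 - z)) _; lra.
have uv (x y : R) : a < x < 1 -> a < y < 1 ->
    h x - k * decay e x <= h y + k * decay e y.
  move=> /andP[ax x1] /andP[ay y1].
  have [xy|yx] := lerP x y.
    apply: le_trans (uP _ _ ax xy y1) _.
    have := mulr_ge0 k0 (ltW (decay_gt0 e y)); lra.
  apply: le_trans _ (vP _ _ ay (ltW yx) x1).
  have := mulr_ge0 k0 (ltW (decay_gt0 e x)); lra.
(* Every value of the upper function bounds all values of the lower one, so the supremum of the
   latter is within [k * decay e z] of [h z]. *)
pose S := [set h x - k * decay e x | x in [set x | a < x < 1]].
have ex x : a < x < 1 -> S (h x - k * decay e x) by move=> ?; exists x.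
have ub y : a < y < 1 -> ubound S (h y + k * decay e y).
  by move=> yy _ [x xx <-]; exact: uv.
have m01 : a < (a + 1) / 2 < 1 by lra.
have S0 : S !=set0 by exists (h ((a + 1) / 2) - k * decay e ((a + 1) / 2)); exact: ex.
have hS : has_sup S by split => //; eexists; exact: ub m01.
exists (sup S), e, k, a; split => //; first by rewrite a0.
move=> z zz; rewrite hornerC ler_norml.
have h1 : h z - k * decay e z <= sup S by apply: sup_upper_bound => //; exact: ex.
have h2 : sup S <= h z + k * decay e z by apply: sup_le_ub => //; exact: ub.
lra.
Qed.

(** By induction half of [d] pays for the quotient polynomial, and the other half pays for the
    factor [x] through [1 + y <= expR y]. *)
Lemma horner_expR_bound P d : 0 < d ->
  exists2 M, 0 <= M & forall x, 0 <= x -> `|P.[x]| <= M * expR (d * x).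
Proof.
elim/poly_ind: P d => [|P c IH] d d0.
  by exists 0 => // x _; rewrite horner0 normr0 mul0r.
have d20 : 0 < d / 2 by rewrite divr_gt0.
have [M M0 HM] := IH _ d20.
exists (M * (d / 2)^-1 + `|c|); first by rewrite addr_ge0// mulr_ge0// invr_ge0 ltW.
move=> x x0; rewrite !hornerE; apply: le_trans (ler_normD _ _) _.
rewrite mulrDl lerD//; last first.
  by rewrite ler_peMr// -expR0 ler_expR mulr_ge0// ltW.
rewrite normrM (ger0_norm x0).
have -> : d * x = d / 2 * x + d / 2 * x by lra.
rewrite expRD mulrACA ler_pM//; first exact: HM.
rewrite mulrC ler_pdivlMr// mulrC.
by have := expR_ge1Dx (d / 2 * x); lra.
Qed.

(** For [P * 'X + c] the hypothesis bounds [P.[x] * x], so [P] is also [O(1 / x)] and vanishes by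
    induction; then [c] is a constant bounded by [C / x]. *)
Lemma poly_decay_eq0 P C A : 1 <= A ->
  (forall x, A < x -> `|P.[x]| <= C / x) -> P = 0.
Proof.
elim/poly_ind: P C => [//|P c IH] C A1 H.
have C0 : 0 <= C.
  have A10 : 0 < A + 1 by lra.
  have := H (A + 1) _; rewrite ltrDl ltr01 => /(_ isT) /(le_trans (normr_ge0 _)).
  by rewrite pmulr_lge0// invr_gt0.
have P0 : P = 0.
  apply: (IH (`|c| + C)) => // x Ax; have x0 : 0 < x by lra.
  have := H x Ax; rewrite !hornerE => Hx.
  rewrite ler_pdivlMr// -{2}(gtr0_norm x0) -normrM -[P.[x] * x](addrK c).
  apply: le_trans (ler_normB _ _) _; rewrite addrC lerD2l; apply: le_trans Hx _.
  by rewrite ler_pdivrMr// ler_peMr//; lra.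
rewrite P0 mul0r add0r; apply/eqP; rewrite polyC_eq0 -normr_le0.
rewrite leNgt; apply/negP => c0.
set x := A + C / `|c| + 1.
have h1 : 0 <= C / `|c| by rewrite divr_ge0.
have xA : A < x by rewrite /x; lra.
have x0 : 0 < x by lra.
have := H x xA; rewrite P0 !hornerE ler_pdivlMr// => h2.
have : C < `|c| * x.
  rewrite mulrC -ltr_pdivrMr// /x; lra.
lra.
Qed.

Lemma asym_common f g P Q : asym f P -> asym g Q -> exists e C a,
  [/\ 0 < e, 0 <= C, 0 <= a < 1 & forall z, a < z < 1 ->
   `|f z - P.[logT z]| <= C * decay e z /\ `|g z - Q.[logT z]| <= C * decay e z].
Proof.
move=> [e [C [a [e0 C0 /andP[a0 a1] H]]]] [e' [C' [a' [e0' C0' /andP[a0' a1'] H']]]].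
exists (Num.min e e'), (C + C'), (Num.max a a'); split.
- by rewrite lt_min e0 e0'.
- exact: addr_ge0.
- by rewrite le_max a0 gt_max a1 a1'.
move=> z; rewrite gt_max => /andP[/andP[az az'] z1].
have z01 : 0 <= z < 1 by rewrite z1 andbT ltW// (le_lt_trans a0).
split.
  apply: le_trans (H z _) _; first by rewrite az.
  apply: (@le_trans _ _ (C * decay (Num.min e e') z)).
    by rewrite ler_wpM2l// decay_le// ge_min lexx.
  by rewrite ler_wpM2r ?(ltW (decay_gt0 _ _))// lerDl.
apply: le_trans (H' z _) _; first by rewrite az'.
apply: (@le_trans _ _ (C' * decay (Num.min e e') z)).
  by rewrite ler_wpM2l// decay_le// ge_min lexx orbT.
by rewrite ler_wpM2r ?(ltW (decay_gt0 _ _))// lerDr.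
Qed.

(** At [x = logT z] the difference is at most [2 * C * expR (- (e * x))], hence at most
    [2 * C / e / x], and [logT] takes every nonnegative value. *)
Lemma asym_unique f P Q : asym f P -> asym f Q -> P = Q.
Proof.
move=> fP fQ; have [e [C [a [e0 C0 /andP[a0 a1] H]]]] := asym_common fP fQ.
have La : 0 <= logT a by rewrite logT_ge0// a0.
apply/eqP; rewrite -subr_eq0; apply/eqP.
apply: (@poly_decay_eq0 _ (2 * C / e) (logT a + 1)); first by lra.
move=> x xA; have x0 : 0 < x by lra.
have [z /andP[z0 z1] zx] := logT_surj (ltW x0).
have az : a < z by rewrite -logT_lt// zx; lra.
have [|h1 h2] := H z; first by rewrite az.
rewrite hornerD hornerN -zx.
have -> : P.[logT z] - Q.[logT z] = (f z - Q.[logT z]) - (f z - P.[logT z]) by lra.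
apply: le_trans (ler_normB _ _) _.
apply: le_trans (lerD h2 h1) _.
have -> : C * decay e z + C * decay e z = 2 * C * decay e z by ring.
rewrite -!mulrA !ler_wpM2l// /decay zx -invfM expRN lef_pV2 ?posrE ?expR_gt0 ?mulr_gt0//.
by have := expR_ge1Dx (e * x); lra.
Qed.

Lemma asymD f g P Q : asym f P -> asym g Q -> asym (fun z => f z + g z) (P + Q).
Proof.
move=> fP fQ; have [e [C [a [e0 C0 a01 H]]]] := asym_common fP fQ.
exists e, (C + C), a; split => //; first exact: addr_ge0.
move=> z /H [h1 h2]; rewrite hornerD opprD addrACA mulrDl.
exact: le_trans (ler_normD _ _) (lerD h1 h2).
Qed.

Lemma asym_horner P : asym (fun z => P.[logT z]) P.
Proof.
exists 1, 0, 0; split => //; first by rewrite lexx ltr01.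
by move=> z _; rewrite subrr normr0 mul0r.
Qed.

Lemma asym_ext f g P : (forall z, 0 <= z < 1 -> f z = g z) -> asym f P -> asym g P.
Proof.
move=> fg [e [C [a [e0 C0 /andP[a0 a1] H]]]]; exists e, C, a; split => //.
  by rewrite a0.
move=> z zz; rewrite -fg; first exact: H.
by case/andP: zz => az ->; rewrite (le_trans a0 (ltW az)).
Qed.

Lemma asym_sum (I : eqType) (s : seq I) (F : I -> R -> R) (p : I -> {poly R}) :
  (forall i, i \in s -> asym (F i) (p i)) ->
  asym (fun z => \sum_(i <- s) F i z) (\sum_(i <- s) p i).
Proof.
elim: s => [|i s IH] H.
  by rewrite big_nil; apply: asym_ext (asym_horner 0) => z _; rewrite horner0 big_nil.
rewrite big_cons.
have Hi : asym (F i) (p i) by apply: H; rewrite mem_head.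
have Hs := IH (fun j js => H j (mem_behead (s := i :: s) js)).
by apply: asym_ext (asymD Hi Hs) => z _; rewrite big_cons.
Qed.

(** Every term of the error contains [f - P] or [g - Q]; the growth of the polynomial in front costs
    half of the exponent [e]. *)
Lemma asymM f g P Q : asym f P -> asym g Q -> asym (fun z => f z * g z) (P * Q).
Proof.
move=> fP fQ; have [e [C [a [e0 C0 /andP[a0 a1] H]]]] := asym_common fP fQ.
have e20 : 0 < e / 2 by rewrite divr_gt0.
have [M M0 HM] := horner_expR_bound P e20; have [N N0 HN] := horner_expR_bound Q e20.
exists (e / 2), (C * C + M * C + N * C), a; split => //.
- by rewrite !addr_ge0// mulr_ge0.
- by rewrite a0.
move=> z /[dup] /H [h1 h2] /andP[az z1].
have z01 : 0 <= z < 1 by rewrite z1 andbT ltW// (le_lt_trans a0).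
have T0 := logT_ge0 z01.
have split_decay : decay e z = decay (e / 2) z * decay (e / 2) z.
  by rewrite /decay -expRD; congr expR; lra.
have edecay : expR (e / 2 * logT z) * decay e z = decay (e / 2) z.
  by rewrite /decay -expRD; congr expR; lra.
have d1 : decay (e / 2) z <= 1.
  by rewrite /decay -[leRHS]expR0 ler_expR oppr_le0 mulr_ge0// ltW.
have D0 := decay_gt0 (e / 2) z.
rewrite hornerM.
have -> : f z * g z - P.[logT z] * Q.[logT z] =
  (f z - P.[logT z]) * (g z - Q.[logT z]) + P.[logT z] * (g z - Q.[logT z])
  + Q.[logT z] * (f z - P.[logT z]) by ring.
apply: le_trans (ler_normD _ _) _; rewrite [leRHS]mulrDl lerD//.
  apply: le_trans (ler_normD _ _) _; rewrite [leRHS]mulrDl lerD//.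
    rewrite normrM; apply: le_trans (ler_pM _ _ h1 h2) _ => //.
    rewrite mulrACA ler_wpM2l ?mulr_ge0//.
    rewrite split_decay -mulrA ler_piMr ?(ltW D0)//.
    by rewrite -split_decay mulr_ile1 ?(ltW (decay_gt0 _ _))// split_decay mulr_ile1 ?(ltW D0).
  rewrite normrM; apply: le_trans (ler_pM _ _ (HM _ T0) h2) _ => //.
  by rewrite mulrACA edecay.
rewrite normrM; apply: le_trans (ler_pM _ _ (HN _ T0) h1) _ => //.
by rewrite mulrACA edecay.
Qed.

(** The formal antiderivative with zero constant term. *)
Definition poly_int P : {poly R} :=
  \poly_(i < (size P).+1) (P`_i.-1 / i%:R *+ (i != 0%N)).

Lemma deriv_poly_int P : (poly_int P)^`() = P.
Proof.
apply/polyP => i; rewrite coef_deriv coef_poly ltnS /=.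
case: ltnP => h; last by rewrite mul0rn nth_default.
by rewrite mulr1n -[LHS]mulr_natr divfK// pnatr_eq0.
Qed.

(** Since [logT] has derivative [(1 - z)^-1], subtracting the antiderivative of [P] at [logT] leaves
    a derivative [O((1 - z) ^ (e - 1))], as [asym_const] demands. *)
Lemma asym_int1 f g P :
  (forall z, 0 < z < 1 -> is_derive z 1 f ((1 - z)^-1 * g z)) ->
  asym g P -> exists Q, asym f Q.
Proof.
move=> d [e [C [a [e0 C0 /andP[a0 a1] H]]]].
pose Q := poly_int P.
have dQ z : z < 1 -> is_derive z 1 (horner Q \o logT) (P.[logT z] * (1 - z)^-1).
  move=> z1; have dT := logT_derive z1.
  by apply: (is_derive_eq (is_derive1_comp (is_derive_poly _ _) dT)); rewrite deriv_poly_int.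
have [c fc] : exists c, asym (f - (horner Q \o logT)) c%:P.
  apply: (@asym_const _ (fun z => (1 - z)^-1 * g z - P.[logT z] * (1 - z)^-1) e C a) => //.
  - by rewrite a0.
  - move=> z /andP[az z1]; apply: is_deriveB; last exact: dQ.
    by apply: d; rewrite z1 andbT (le_lt_trans a0).
  - move=> z zz; have /andP[az z1] := zz.
    rewrite [(1 - z)^-1 * g z]mulrC -mulrBl normrM (@ger0_norm _ (1 - z)^-1).
      by rewrite ler_wpM2r ?H// invr_ge0 subr_ge0 ltW.
    by rewrite invr_ge0 subr_ge0 ltW.
exists (c%:P + Q); apply: asym_ext (asymD fc (asym_horner Q)) => z _ /=.
by rewrite !fctE /= subrK.
Qed.

(** Near 1, [g] grows at most polynomially in [logT], hence is [O((1 - z) ^ (-1/2))], so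
    [asym_const] applies with exponent 1/2. The factor 2 bounds [z^-1] past 1/2. *)
Lemma asym_int0 f g P :
  (forall z, 0 < z < 1 -> is_derive z 1 f (z^-1 * g z)) ->
  asym g P -> exists c, asym f c%:P.
Proof.
move=> d [e [C [a [e0 C0 /andP[a0 a1] H]]]].
have h20 : (0 : R) < 1 / 2 by lra.
have [M M0 HM] := horner_expR_bound P h20.
apply: (@asym_const f (fun z => z^-1 * g z) (1 / 2) (2 * (M + C)) (Num.max a (1 / 2))) => //.
- by rewrite mulr_ge0// addr_ge0.
- by rewrite le_max a0 gt_max a1; lra.
- by move=> z; rewrite gt_max => /andP[/andP[az hz] z1]; apply: d; lra.
move=> z; rewrite gt_max => /andP[/andP[az hz] z1].
have z0 : 0 < z by lra.
have z01 : 0 <= z < 1 by rewrite z1 ltW.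
have T0 := logT_ge0 z01.
have Hz : `|g z - P.[logT z]| <= C * decay e z by apply: H; rewrite az.
have d1 : decay e z <= 1.
  by rewrite /decay -[leRHS]expR0 ler_expR oppr_le0 mulr_ge0// ltW.
have E1 : 1 <= expR (1 / 2 * logT z) by rewrite -[leLHS]expR0 ler_expR mulr_ge0// ltW.
have -> : 2 * (M + C) * decay (1 / 2) z / (1 - z) = 2 * ((M + C) * expR (1 / 2 * logT z)).
  rewrite -expR_logT// -!mulrA /decay -expRD; congr (_ * (_ * expR _)); lra.
rewrite normrM ler_pM//.
  by rewrite ger0_norm ?invr_ge0 ?(ltW z0)// -(invrK 2) lef_pV2 ?posrE//; lra.
rewrite -[g z](subrK P.[logT z]); apply: le_trans (ler_normD _ _) _.
rewrite addrC mulrDl lerD ?HM//; apply: le_trans Hz _.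
by rewrite ler_wpM2l// (le_trans d1).
Qed.

End Asymptotics.

(** * Existence of expansions for multiple polylogarithms *)

Section Existence.
Context {R : realType}.
Implicit Types (w : seq nat).

Lemma asym_Lr w : is_index w -> exists P, asym (@Lr R w) P.
Proof.
elim: w => [_|j w IH].
  exists 1; apply: asym_ext (asym_horner 1) => z _.
  by rewrite Lr_nil hornerC.
case: j => [//|j] /= hw; have [P HP] := IH hw.
elim: j => [|j [Q HQ]].
  apply: asym_int1 HP => z /andP[z0 z1].
  by apply: Lr_derive1; rewrite gtr0_norm.
have [c Hc] := asym_int0 (@Lr_deriveS R j w) HQ.
by exists c%:P.
Qed.

(** The constant is only shown to exist here; [zeta_asym] identifies it. *)
Lemma asym_Lr_const j w : is_index w -> exists c, asym (@Lr R (j.+2 :: w)) c%:P.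
Proof.
move=> hw; have [Q HQ] := @asym_Lr (j.+1 :: w) hw.
exact: asym_int0 (@Lr_deriveS R j w) HQ.
Qed.

End Existence.


(** * The sum over all indices of given weight and depth *)

(** The head is the last entry [k_r]. Fixing the empty list makes the map injective. *)
Definition incr_head (w : seq nat) : seq nat :=
  if w is j :: w' then j.+1 :: w' else [::].

(* The reversed indices of depth r and weight r + k, enumerated according to
   whether the last entry k_r of the index is 1 or larger. *)
Fixpoint idx (r : nat) : nat -> seq (seq nat) :=
  match r with
  | 0 => fun k => if k is 0 then [:: [::]] else [::]
  | r'.+1 => fix idxr k :=
      match k with
      | 0 => map (cons 1%N) (idx r' 0)
      | k'.+1 => map (cons 1%N) (idx r' k'.+1) ++ map incr_head (idxr k')
      end
  end.

Lemma idxS0 r : idx r.+1 0 = map (cons 1%N) (idx r 0). Proof. by []. Qed.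

Lemma idxSS r k :
  idx r.+1 k.+1 = map (cons 1%N) (idx r k.+1) ++ map incr_head (idx r.+1 k).
Proof. by []. Qed.

Lemma idx0 r : idx r 0 = [:: nseq r 1%N].
Proof. by elim: r => // r IH; rewrite idxS0 IH. Qed.

Lemma is_index_sumn w : is_index w -> (size w <= sumn w)%N.
Proof. by elim: w => //= j w IH /andP[j0 /IH]; lia. Qed.

Lemma incr_head_inj : injective incr_head.
Proof. by case=> [|? ?] [|? ?] //= [-> ->]. Qed.

Lemma mem_idx r k w :
  (w \in idx r k) = [&& size w == r, is_index w & sumn w == r + k]%N.
Proof.
elim: r k w => [|r IHr] k w; first by case: k w => [|k] [|j w].
have cons1E u v : (1%N :: u \in map (cons 1%N) v) = (u \in v).
  by rewrite mem_map// => ? ? [].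
have consE j u v : (j.+2 :: u \in map (cons 1%N) v) = false.
  by apply/negP => /mapP[? _].
have nilE v : ([::] \in map (cons 1%N) v) = false by apply/negP => /mapP[].
have zeroE u v : (0%N :: u \in map (cons 1%N) v) = false by apply/negP => /mapP[].
elim: k w => [|k IHk] w.
  rewrite idxS0; case: w => [|[|[|j]] w]; rewrite ?nilE ?zeroE ?cons1E ?consE ?andbF //=.
  (* What remains is a head of at least 2: the other entries being positive, the weight exceeds the
     depth. *)
  rewrite addn0; apply/esym/negP => /and3P[/eqP[sw] /is_index_sumn h /eqP]; lia.
rewrite idxSS mem_cat.
case: w => [|[|[|j]] w]; rewrite ?nilE ?zeroE ?cons1E ?consE ?andbF /=.
- by rewrite -[[::]]/(incr_head [::]) (mem_map incr_head_inj) IHk.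
- by apply/negP => /mapP[[|a u]].
- rewrite IHr (_ : (_ \in map incr_head _) = false) ?orbF ?eqSS//.
  by apply/negP => /mapP[[|[|a] u] //]; rewrite IHk andbF.
- rewrite -[_ :: w]/(incr_head (j.+1 :: w)) (mem_map incr_head_inj) IHk /=.
  by congr [&& _, _ & _]; apply/eqP/eqP; lia.
Qed.

Lemma uniq_idx r k : uniq (idx r k).
Proof.
elim: r k => [|r IHr] k; first by case: k.
have inj1 : injective (cons 1%N) by move=> ? ? [].
elim: k => [|k IHk]; first by rewrite idx0.
rewrite idxSS cat_uniq !map_inj_uniq ?IHr ?IHk ?andbT ?andTb//; last exact: incr_head_inj.
apply/hasPn => _ /mapP[u + ->]; rewrite mem_idx => /and3P[].
by case: u => [|[|a] u] //= _ _ _; apply/negP => /mapP[].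
Qed.

(** Both sides run over the same indices without repetition, so they differ by a permutation. *)
Lemma big_index_tuple (V : nmodType) r k (F : seq nat -> V) :
  \sum_(s : r.-tuple 'I_(r + k).+1 |
          is_index [seq nat_of_ord i | i <- s]
          && (wt [seq nat_of_ord i | i <- s] == (r + k)%N))
     F [seq nat_of_ord i | i <- s] = \sum_(w <- idx r k) F (rev w).
Proof.
pose vm (s : r.-tuple 'I_(r + k).+1) := [seq nat_of_ord i | i <- s].
rewrite -big_filter -(big_map vm xpredT F) -(big_map rev xpredT F).
apply: perm_big; apply: uniq_perm.
- rewrite map_inj_uniq ?filter_uniq ?index_enum_uniq// => s t.
  by move/(inj_map val_inj)/val_inj.
- by rewrite (map_inj_uniq (can_inj revK)) uniq_idx.
move=> w; rewrite -{2}[w]revK (mem_map (can_inj revK)) mem_idx size_rev sumn_rev.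
rewrite /is_index all_rev -/(is_index w); apply/mapP/and3P => [[s]|[/eqP sw iw /eqP ww]].
  by rewrite mem_filter => /andP[/andP[h1 h2] _] ->; rewrite size_map size_tuple.
have szs : size (map (@inord (r + k)) w) == r by rewrite size_map sw.
have E : vm (Tuple szs) = w.
  rewrite /vm /= -map_comp -[RHS]map_id; apply/eq_in_map => i iw' /=.
  (* Each entry is at most the weight [r + k], so [inord] leaves it unchanged. *)
  rewrite inordK// ltnS -ww; elim: (w) iw' => //= a u IH.
  by rewrite inE => /orP[/eqP->|/IH]; lia.
exists (Tuple szs) => //; rewrite mem_filter mem_index_enum andbT.
by move: E iw; rewrite /vm /is_index => -> ->; rewrite /wt ww eqxx.
Qed.

(** * The identity for sums of polylogarithms, by comparison of derivatives *)

Section Identity.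
Context {R : realType}.
Implicit Types (f g d : R -> R) (w : seq nat) (x z : R).

Lemma is_derive_bigsum (I : eqType) (s : seq I) (F : I -> R -> R) (dF : I -> R) x :
  (forall i, i \in s -> is_derive x 1 (F i) (dF i)) ->
  is_derive x 1 (fun z => \sum_(i <- s) F i z) (\sum_(i <- s) dF i).
Proof.
elim: s => [|i s IH] H.
  rewrite big_nil (_ : (fun z => _) = cst 0); first exact: is_derive_cst.
  by apply/funext => z; rewrite big_nil.
rewrite big_cons (_ : (fun z => _) = F i + (fun z => \sum_(i <- s) F i z)).
  apply: is_deriveD; first by apply: H; rewrite mem_head.
  by apply: IH => j js; apply: H; rewrite inE js orbT.
by apply/funext => z; rewrite big_cons.
Qed.

(** [df] and [dg] give continuity up to 0; the common derivative [d], possibly singular at 0, makes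
    the difference constant. *)
Lemma derive_eq_on01 f g (df dg : R -> R) d :
  f 0 = g 0 ->
  (forall z, `|z| < 1 -> is_derive z 1 f (df z)) ->
  (forall z, `|z| < 1 -> is_derive z 1 g (dg z)) ->
  (forall z, 0 < z < 1 -> is_derive z 1 f (d z)) ->
  (forall z, 0 < z < 1 -> is_derive z 1 g (d z)) ->
  forall z, 0 <= z < 1 -> f z = g z.
Proof.
move=> fg0 Df Dg df' dg' z /andP[z0 z1]; apply/eqP; rewrite -subr_eq0; apply/eqP.
have sub x : 0 <= x <= z -> `|x| < 1 by move=> ?; rewrite ger0_norm; lra.
suff -> : f z - g z = (f - g) 0 by rewrite !fctE /= fg0 subrr.
apply: (@is_derive_eq0 _ (f - g) (fun x => d x - d x) 0 z) => //.
- apply: (@is_derive_continuous_within _ _ (fun x => df x - dg x)) => x /sub x1.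
  by apply: is_deriveB; [exact: Df|exact: Dg].
- move=> x x0z; have x01 : 0 < x < 1 by lra.
  by apply: is_deriveB; [exact: df'|exact: dg'].
- by move=> x _; rewrite subrr.
Qed.

Lemma Lr_is_derive w z : `|z| < 1 ->
  is_derive z 1 (@Lr R w) (psum (pseries_diffs (mcoef w)) z).
Proof. by move=> z1; apply: psum_derive => //; exact: tame_mcoef. Qed.

(** For a positive number of ones both sides vanish at 0 and, by induction, have the same
    derivative. *)
Lemma Lr_ones n z : 0 <= z < 1 -> Lr (nseq n 1%N) z = logT z ^+ n / n`!%:R.
Proof.
elim: n z => [|n IH] z z01; first by rewrite Lr_nil expr0 fact0 divr1.
have D x : x < 1 -> is_derive x 1 ((n.+1`!%:R)^-1 \*: (logT ^+ n.+1 : R -> R))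
    ((n.+1`!%:R)^-1 * (n.+1%:R * logT x ^+ n * (1 - x)^-1)).
  by move=> x1; have dT := logT_derive x1; exact: (is_deriveZ _ (is_deriveX _ dT)).
set g := ((n.+1`!%:R)^-1 \*: _) in D.
have Dn x : `|x| < 1 ->
    is_derive x 1 g
      ((n.+1`!%:R)^-1 * (n.+1%:R * logT x ^+ n * (1 - x)^-1)).
  by move=> x1; apply: D; apply: le_lt_trans x1; exact: ler_norm.
have g0 : Lr (nseq n.+1 1%N) 0 = g 0.
  by rewrite Lr_cons0 /g !fctE /= /logT subr0 ln1 oppr0 expr0n scaler0.
have D1 x : 0 < x < 1 ->
    is_derive x 1 (Lr (nseq n.+1 1%N)) ((1 - x)^-1 * Lr (nseq n 1%N) x).
  by move=> /andP[x0 x1]; apply: Lr_derive1; rewrite gtr0_norm.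
have D2 x : 0 < x < 1 -> is_derive x 1 g ((1 - x)^-1 * Lr (nseq n 1%N) x).
  move=> /andP[x0 x1]; apply: (is_derive_eq (D x x1)).
  rewrite IH ?x1 ?ltW// factS natrM invfM.
  have h1 : n.+1%:R != 0 :> R by rewrite pnatr_eq0.
  have h2 : n`!%:R != 0 :> R by rewrite pnatr_eq0 -lt0n fact_gt0.
  have h3 : 1 - x != 0 by rewrite gt_eqF// subr_gt0.
  by field; rewrite h2 h3 nat1r.
rewrite (derive_eq_on01 g0 (@Lr_is_derive _) Dn D1 D2 z01).
by rewrite /g !fctE /= mulrC.
Qed.

(** The value 0 at [n = 0] lets [Lr_ones_derive] cover the constant function 1. *)
Definition Lr_ones' n z : R := if n is n'.+1 then Lr (nseq n' 1%N) z else 0.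

Lemma Lr_ones_derive n z : `|z| < 1 ->
  is_derive z 1 (@Lr R (nseq n 1%N)) ((1 - z)^-1 * Lr_ones' n z).
Proof.
move=> z1; case: n => [|n]; last exact: Lr_derive1.
rewrite mulr0 (_ : Lr _ = cst 1); first exact: is_derive_cst.
by apply/funext => x; rewrite Lr_nil.
Qed.

(** The case [k = 0] of [sum_Lr_idx]. By [Lr_ones] each term is a signed binomial multiple of the
    right-hand side. *)
Lemma alternating_ones (r : nat) z : 0 <= z < 1 ->
  \sum_(i < r.+1) (-1) ^+ i * (Lr (nseq (r - i) 1%N) z * Lr (nseq i.+1 1%N) z)
  = Lr (nseq r.+1 1%N) z.
Proof.
move=> z01; have fn0 n : n`!%:R != 0 :> R by rewrite pnatr_eq0 -lt0n fact_gt0.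
have E : \sum_(i < r.+2) (-1) ^+ i * 'C(r.+1, i)%:R = 0 :> R.
  have := exprBn (1 : R) 1 r.+1; rewrite subrr expr0n /= => /esym E.
  by rewrite -[RHS]E; apply: eq_bigr => i _; rewrite !expr1n !mulr1 mulr_natr.
(* In the expansion of [(1 - 1) ^ r.+1 = 0] the first term is 1, so the others, with signs reversed,
   sum to 1. *)
rewrite big_ord_recl /= expr0 bin0 mulr1 in E.
have -> : Lr (nseq r.+1 1%N) z = \sum_(i < r.+1)
    (-1) ^+ i * 'C(r.+1, i.+1)%:R * Lr (nseq r.+1 1%N) z.
  rewrite -mulr_suml -[LHS]mul1r; congr (_ * _).
  apply/subr0_eq; rewrite -[RHS]E -sumrN; congr (_ + _).
  by apply: eq_bigr => i _; rewrite exprS mulN1r mulNr.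
apply: eq_bigr => i _; rewrite -mulrA; congr (_ * _); rewrite !Lr_ones//.
have ir : (i <= r)%N by rewrite -ltnS.
have <- : 'C(r.+1, i.+1)%:R * (i.+1`!%:R * (r - i)`!%:R) = r.+1`!%:R :> R.
  by rewrite -!natrM -subSS bin_fact.
have -> : logT z ^+ r.+1 = logT z ^+ (r - i) * logT z ^+ i.+1.
  by rewrite -exprD addnS subnK.
have b0 : 'C(r.+1, i.+1)%:R != 0 :> R by rewrite pnatr_eq0 -lt0n bin_gt0.
move: (fn0 i.+1) (fn0 (r - i)%N) b0.
move: (i.+1`!%:R : R) ((r - i)`!%:R : R) ('C(r.+1, i.+1)%:R : R) => A B D A0 B0 D0.
by field; rewrite A0 B0 D0.
Qed.

Lemma sum_Lr_idx_derive r k x : 0 < x < 1 ->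
  is_derive x 1 (fun z => \sum_(w <- idx r.+1 k.+1) @Lr R w z)
    ((1 - x)^-1 * \sum_(w <- idx r k.+1) Lr w x
     + x^-1 * \sum_(w <- idx r.+1 k) Lr w x).
Proof.
move=> x01; have /andP[x0 x1] := x01.
have -> : (fun z => \sum_(w <- idx r.+1 k.+1) @Lr R w z) =
    (fun z => \sum_(w <- idx r k.+1) Lr (1%N :: w) z)
    + (fun z => \sum_(w <- idx r.+1 k) Lr (incr_head w) z).
  by apply/funext => z; rewrite idxSS big_cat !big_map.
rewrite !mulr_sumr; apply: is_deriveD; apply: is_derive_bigsum => w.
  by move=> _; apply: Lr_derive1; rewrite gtr0_norm.
rewrite mem_idx => /and3P[]; case: w => [|[|j] w] // _ _ _.
exact: Lr_deriveS.
Qed.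

(** In the product rule, differentiating the ones produces the sum in [pre], and differentiating the
    other factor produces the sum with [k] lowered. *)
Lemma sum_Lr_idx_step r k :
  (forall x, 0 < x < 1 -> \sum_(w <- idx r k.+1) Lr w x = \sum_(i < r.+1)
     (-1) ^+ i * (Lr_ones' (r - i) x * Lr (k.+2 :: nseq i 1%N) x)) ->
  (forall x, 0 <= x < 1 -> \sum_(w <- idx r.+1 k) Lr w x = \sum_(i < r.+1)
     (-1) ^+ i * (Lr (nseq (r - i) 1%N) x * Lr (k.+1 :: nseq i 1%N) x)) ->
  forall z : R, 0 <= z < 1 -> \sum_(w <- idx r.+1 k.+1) Lr w z = \sum_(i < r.+1)
     (-1) ^+ i * (Lr (nseq (r - i) 1%N) z * Lr (k.+2 :: nseq i 1%N) z).
Proof.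
move=> pre IHk z z01.
pose F (i : 'I_r.+1) : R -> R :=
  (-1) ^+ i \*: (@Lr R (nseq (r - i) 1%N) * @Lr R (k.+2 :: nseq i 1%N)).
(* The derivative of the second factor is a parameter: the termwise [dl1] is valid on the whole
   disc, 0 included, whereas [dl2] is used for [x > 0]. *)
pose dF (dl : nat -> R -> R) (i : 'I_r.+1) (x : R) :=
  (-1) ^+ i * (Lr (nseq (r - i) 1%N) x * dl i x
    + Lr (k.+2 :: nseq i 1%N) x * ((1 - x)^-1 * Lr_ones' (r - i) x)).
have DF (dl : nat -> R -> R) (i : 'I_r.+1) (x : R) : `|x| < 1 ->
    is_derive x 1 (Lr (k.+2 :: nseq i 1%N)) (dl i x) ->
    is_derive x 1 (F i) (dF dl i x).
  move=> x1 d2; have d1 := Lr_ones_derive (r - i) x1.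
  exact: (is_deriveZ _ (is_deriveM d1 d2)).
pose g (x : R) : R := \sum_(i < r.+1) F i x.
pose dl1 (i : nat) (x : R) := psum (pseries_diffs (mcoef (k.+2 :: nseq i 1%N))) x.
pose dl2 (i : nat) (x : R) := x^-1 * Lr (k.+1 :: nseq i 1%N) x.
have g0 : \sum_(w <- idx r.+1 k.+1) Lr w 0 = g 0.
  rewrite big1_seq ?/g ?big1// => [i _|w /andP[_]].
    rewrite -[LHS]/((-1) ^+ i * (Lr (nseq (r - i) 1%N) 0 * Lr (k.+2 :: nseq i 1%N) 0)).
    by rewrite Lr_cons0 !mulr0.
  by rewrite mem_idx => /and3P[]; case: w => // j w _ _ _; rewrite Lr_cons0.
have Df x : `|x| < 1 -> is_derive x 1 (fun z => \sum_(w <- idx r.+1 k.+1) @Lr R w z)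
    (\sum_(w <- idx r.+1 k.+1) psum (pseries_diffs (mcoef w)) x).
  by move=> x1; apply: is_derive_bigsum => w _; exact: Lr_is_derive.
have Dg x : `|x| < 1 -> is_derive x 1 g (\sum_(i < r.+1) dF dl1 i x).
  by move=> x1; apply: is_derive_bigsum => i _; apply: DF => //; exact: Lr_is_derive.
have Dg1 x : 0 < x < 1 -> is_derive x 1 g ((1 - x)^-1 * \sum_(w <- idx r k.+1) Lr w x
     + x^-1 * \sum_(w <- idx r.+1 k) Lr w x).
  move=> x01; have /andP[x0 x1] := x01.
  have D : is_derive x 1 g (\sum_(i < r.+1) dF dl2 i x).
    apply: is_derive_bigsum => i _; apply: DF; first by rewrite gtr0_norm.
    exact: Lr_deriveS.
  apply: (is_derive_eq D); rewrite pre// IHk ?x1 ?ltW// !mulr_sumr -big_split /=.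
  by apply: eq_bigr => i _; rewrite /dF /dl2; ring.
rewrite (derive_eq_on01 g0 Df Dg (@sum_Lr_idx_derive r k) Dg1 z01).
by apply: eq_bigr.
Qed.

(** Induction on [r], then on [k]: the derivative at [k.+1] involves the smaller depth with the same
    [k.+1] and the same depth with [k]. *)
Lemma sum_Lr_idx r k z : 0 <= z < 1 ->
  \sum_(w <- idx r.+1 k) Lr w z =
  \sum_(i < r.+1) (-1) ^+ i * (Lr (nseq (r - i) 1%N) z * Lr (k.+1 :: nseq i 1%N) z).
Proof.
elim: r k z => [|r IHr] k z; elim: k z => [|k IHk] z z01.
1,3: by rewrite idx0 big_seq1 -alternating_ones//.
- have pre x : 0 < x < 1 -> \sum_(w <- idx 0 k.+1) Lr w x =
    \sum_(i < 1) (-1) ^+ i * (Lr_ones' (0 - i) x * Lr (k.+2 :: nseq i 1%N) x).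
    by move=> _; rewrite big_nil big_ord1 mul0r mulr0.
  exact: sum_Lr_idx_step pre IHk z z01.
- have pre x : 0 < x < 1 -> \sum_(w <- idx r.+1 k.+1) Lr w x =
    \sum_(i < r.+2) (-1) ^+ i * (Lr_ones' (r.+1 - i) x * Lr (k.+2 :: nseq i 1%N) x).
    (* The extra term [i = r.+1] carries [Lr_ones' 0], which is 0. *)
    move=> /andP[x0 x1]; rewrite IHr ?x1 ?ltW// [RHS]big_ord_recr /= subnn mul0r mulr0 addr0.
    by apply: eq_bigr => i _; rewrite subSn// -ltnS.
  exact: sum_Lr_idx_step pre IHk z z01.
Qed.

End Identity.


(** * Regularized and convergent values *)

Section Truncations.
Context {R : realType}.
Implicit Types (k w : seq nat) (P : {poly R}) (z : R).

Lemma incr_rcons r N (t : r.-tuple 'I_N.+1) (y : 'I_N.+1) :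
  incr (rcons_tuple t y)
  = incr t && (last 0%N [seq nat_of_ord i | i <- t] < y)%N.
Proof. by rewrite /incr /= map_rcons rcons_path. Qed.

(** The condition on the new entry becomes a 0/1 factor in the last entry of [t], the shape that
    [big_incr_tuple] handles. *)
Lemma big_rcons_tuple (r N : nat) (F : r.+1.-tuple 'I_N.+1 -> R) :
  \sum_(m | incr m) F m
  = \sum_(y < N.+1) \sum_(t : r.-tuple 'I_N.+1 | incr t)
      (last 0%N [seq nat_of_ord i | i <- t] < y)%:R * F (rcons_tuple t y).
Proof.
rewrite (reindex (fun p : r.-tuple 'I_N.+1 * 'I_N.+1 => rcons_tuple p.1 p.2)).
  under eq_bigl do rewrite incr_rcons.
  rewrite exchange_big /= pair_big_dep /= big_mkcondr; apply: eq_big => [p|p _].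
    by rewrite andbT.
  by case: ifP => _; rewrite ?mul1r ?mul0r.
exists (fun m => ([tuple of belast (thead m) (behead m)], last (thead m) (behead m))).
  move=> [t y] _; congr pair.
    apply: val_inj => /=; case: t => -[|a s] i //=.
    by rewrite belast_rcons.
  by case: t => -[|a s] i //=; rewrite last_rcons.
move=> m _; apply: val_inj; rewrite /= -lastI.
by rewrite [in RHS](tuple_eta m).
Qed.

(* Summing an arbitrary function of the last entry lets the induction absorb
   the constraint m_r < m_{r+1}. *)
Lemma big_incr_tuple N r k (phi : nat -> R) : size k = r ->
  \sum_(m : r.-tuple 'I_N.+1 | incr m)
     phi (last 0%N [seq nat_of_ord i | i <- m])
     / \prod_(j < r) (tnth m j)%:R ^+ nth 0%N k j
  = \sum_(i < N.+1) phi i * mcoef (rev k) i.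
Proof.
elim: r k phi => [|r IH] k phi sk.
  rewrite (size0nil sk) (big_pred1 [tuple]) => [|m]; last by rewrite tuple0.
  rewrite big_ord0 divr1 big_ord_recl /= mulr1 big1 ?addr0// => i _.
  by rewrite mulr0.
case/lastP: k sk => // k j; rewrite size_rcons => -[sk].
rewrite big_rcons_tuple; apply: eq_bigr => y _.
rewrite rev_rcons /=.
have -> : \sum_(i < y) mcoef (rev k) i = \sum_(i < N.+1) (i < y)%N%:R * mcoef (rev k) i :> R.
  rewrite (big_ord_widen _ (fun i => mcoef (rev k) i) (ltnW (ltn_ord y))) big_mkcond /=.
  by apply: eq_bigr => i _; case: ifP => _; rewrite ?mul1r ?mul0r.
rewrite -(IH k (fun i => (i < y)%N%:R))// !mulr_sumr; apply: eq_bigr => t _.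
rewrite map_rcons last_rcons big_ord_recr /=.
have -> : tnth (rcons_tuple t y) ord_max = y.
  by rewrite (tnth_nth ord0) /= nth_rcons size_tuple ltnn eqxx.
rewrite nth_rcons sk ltnn eqxx.
have -> : \prod_(i < r) (tnth (rcons_tuple t y) (widen_ord (leqnSn r) i))%:R
     ^+ nth 0%N (rcons k j) (widen_ord (leqnSn r) i)
  = \prod_(i < r) (tnth t i)%:R ^+ nth 0%N k i :> R.
  apply: eq_bigr => i _; rewrite !(tnth_nth ord0) /= !nth_rcons size_tuple sk.
  by rewrite ltn_ord.
by rewrite invfM; ring.
Qed.

(** [pseries] sums strictly below its bound, hence [N.+1] for [m_r <= N]. *)
Lemma Li_truncE k z N : Li_trunc k z N = pseries (mcoef (rev k)) z N.+1.
Proof.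
rewrite /Li_trunc /mdenom (big_incr_tuple _ (fun i => z ^+ i) (erefl (dep k))).
by rewrite /pseries /series /= big_mkord; apply: eq_bigr => i _; rewrite mulrC.
Qed.

Lemma zeta_truncE k N : zeta_trunc R k N = series (mcoef (rev k)) N.+1.
Proof.
rewrite /series /= big_mkord.
have := big_incr_tuple N (fun _ => 1) (erefl (dep k)).
under eq_bigr do rewrite mul1r.
by under [in RHS]eq_bigr do rewrite mul1r.
Qed.

Lemma LiE k z : `|z| < 1 -> Li k z = Lr (rev k) z.
Proof.
move=> z1; apply/cvg_lim => //.
rewrite (_ : (fun N => _) = (fun N => pseries (mcoef (rev k)) z N.+1)).
  by rewrite (cvg_shiftS (pseries (mcoef (rev k)) z)); exact: tame_cvg (tame_mcoef _) z1.
by apply/funext => N; rewrite Li_truncE.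
Qed.

Lemma decayE e z : z < 1 -> (1 - z) `^ e = decay e z.
Proof.
by move=> z1; rewrite /powR subr_eq0 gt_eqF// /decay /logT mulrN opprK.
Qed.

Lemma is_Zsh_asym k P : is_Zsh k P <-> asym (@Lr R (rev k)) P.
Proof.
split.
  case=> e e0 /eqaddOP /bigO_exP [C C0 H].
  have [d /= d0 Hd] := (nbhs_ballP _ _).1 H.
  exists e, C, (Num.max 0 (1 - d)); split => //; first exact: ltW.
    by rewrite le_max lexx gt_max ltr01; lra.
  move=> z; rewrite gt_max => /andP[/andP[z0 dz] z1].
  have bz : ball (1 : R) d z by rewrite /ball /= gtr0_norm; lra.
  have /= := Hd z bz z1; rewrite !fctE decayE// (ger0_norm (ltW (decay_gt0 _ _))).
  by rewrite LiE // (gtr0_norm z0).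
case=> e [C [a [e0 C0 /andP[a0 a1] H]]]; exists e => //.
(* [asym] allows [C = 0], whereas a positive constant is required here. *)
apply/eqaddOP/bigO_exP; exists (C + 1); first by rewrite ltr_wpDl.
near=> z.
have z1 : z < 1 by near: z; exact: nbhs_left_lt.
have az : a < z by near: z; exact: nbhs_left_gt.
have z0 : 0 < z by exact: le_lt_trans az.
rewrite !fctE decayE// (ger0_norm (ltW (decay_gt0 _ _))) LiE ?(gtr0_norm z0)//.
apply: le_trans (H z _) _; first by rewrite az.
by rewrite ler_wpM2r ?(ltW (decay_gt0 _ _))// lerDl.
Unshelve. all: by end_near. Qed.

(** The existence given by [asym_Lr] excludes the default value of [xget]. *)
Lemma Zsh_asym k : is_index k -> asym (@Lr R (rev k)) (Zsh R k).
Proof.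
move=> ik; apply/is_Zsh_asym; apply: xgetPex.
have [P HP] : exists P, asym (@Lr R (rev k)) P by apply: asym_Lr; rewrite /is_index all_rev.
by exists P; apply/is_Zsh_asym.
Qed.

(** If [c < 0], then [|0 - c| <= |f z - c|], so the zero function would have both expansions [c] and
    0, against uniqueness. *)
Lemma asym_ge0 (f : R -> R) (c : R) : asym f c%:P ->
  (forall z, 0 < z < 1 -> 0 <= f z) -> 0 <= c.
Proof.
move=> [e [C [a [e0 C0 /andP[a0 a1] H]]]] f0; rewrite leNgt; apply/negP => c0.
suff /eqP : c%:P = 0 by rewrite polyC_eq0 lt_eqF.
apply: (@asym_unique _ (fun=> 0)).
  exists e, C, a; split => //; first by rewrite a0.
  move=> z zz; apply: le_trans (H z zz); rewrite !hornerC.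
  have fz : 0 <= f z by apply: f0; case/andP: zz => az ->; rewrite (le_lt_trans a0).
  by rewrite sub0r normrN (ltr0_norm c0) ger0_norm; lra.
by apply: asym_ext (asym_horner 0) => z _; rewrite horner0.
Qed.

Lemma asym_id : asym (id : R -> R) 1.
Proof.
exists 1, 1, 0; split => //; first by rewrite lexx ltr01.
move=> z /andP[z0 z1]; rewrite hornerC -decayE// powRr1 ?subr_ge0 ?(ltW z1)//.
by rewrite mul1r distrC ger0_norm// subr_ge0 ltW.
Qed.

Lemma asym_cst (c : R) : asym (fun=> c) c%:P.
Proof. by apply: asym_ext (asym_horner c%:P) => z _; rewrite hornerC. Qed.

Lemma asym_pseries (c : nat -> R) N :
  asym (fun z => pseries c z N) (series c N)%:P.
Proof.
rewrite /pseries /series /= rmorph_sum /=; apply: asym_sum => i _.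
elim: i (c i) => [|i IH] x.
  by apply: asym_ext (asym_cst x) => z _; rewrite expr0 mulr1.
rewrite -[x%:P]mulr1; apply: asym_ext (asymM (IH x) asym_id) => z _.
by rewrite exprSr mulrA.
Qed.

(** Abel summation for nonnegative coefficients: partial sums at [z] lie below [Lr], so those at 1
    are at most [c] and the series converges; conversely [z ^ n <= 1] puts [Lr], hence [c], below
    its sum. *)
Lemma zeta_asym k (c : R) : asym (@Lr R (rev k)) c%:P -> zeta R k = c.
Proof.
move=> Hc; pose u : nat -> R := mcoef (rev k); have u0 := @mcoef_ge0 R (rev k).
have asymB f g (x y : R) :
    asym f x%:P -> asym g y%:P -> asym (fun z => f z - g z) (x - y)%:P.
  move=> fx gy; rewrite polyCB -[y%:P]mul1r -mulN1r mulrA mulr1 -polyCN.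
  apply: asym_ext (asymD fx (asymM (asym_cst (-1)) gy)) => z _.
  by rewrite mulN1r.
have pm z : 0 < z -> nondecreasing_seq (pseries u z).
  move=> z0; apply/nondecreasing_seqP => n; rewrite /pseries seriesSr lerDl.
  by rewrite mulr_ge0// exprn_ge0// ltW.
have um : nondecreasing_seq (series u).
  by apply/nondecreasing_seqP => n; rewrite seriesSr lerDl.
have uc N : series u N <= c.
  rewrite -subr_ge0; apply: asym_ge0 (asymB _ _ _ _ Hc (asym_pseries u N)) _.
  move=> z /andP[z0 z1]; rewrite subr_ge0; apply: nondecreasing_cvgn_le; first exact: pm.
  by apply: tame_cvg (tame_mcoef _) _; rewrite gtr0_norm.
have cu : cvgn (series u).
  by apply: nondecreasing_is_cvgn => //; exists c => _ [n _ <-].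
have zE : zeta R k = limn (series u).
  apply/cvg_lim => //; rewrite (_ : (fun N => _) = (fun N => series u N.+1)).
    by rewrite (cvg_shiftS (series u)).
  by apply/funext => N; rewrite zeta_truncE.
apply/eqP; rewrite zE eq_le; apply/andP; split.
  by apply: limr_le => //; near=> n.
rewrite -subr_ge0; apply: asym_ge0 (asymB _ _ _ _ (asym_cst _) Hc) _.
move=> z /andP[z0 z1]; rewrite subr_ge0; apply: lim_series_le => //.
  by apply: tame_cvg (tame_mcoef _) _; rewrite gtr0_norm.
by move=> n; rewrite ler_piMr// exprn_ile1// ltW.
Unshelve. all: by end_near. Qed.

End Truncations.

(* An entry of an index of weight r + k is at most r + k, so the tuples over
   'I_(r + k).+1 contain every index of that weight and depth exactly once. *)
Theorem theorem2 (R : realType) (r k : nat) (hr : (1 <= r)%N) (hk : (1 <= k)%N) :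
  \sum_(s : r.-tuple 'I_(r + k).+1 |
          is_index [seq nat_of_ord i | i <- s]
          && (wt [seq nat_of_ord i | i <- s] == (r + k)%N))
     zeta_sh R [seq nat_of_ord i | i <- s]
  = (-1) ^+ (r - 1) * zeta R (rcons (nseq (r - 1) 1%N) (k + 1)%N).
Proof.
case: r hr => // r _; case: k hk => // k _.
rewrite (big_index_tuple _ _ (zeta_sh R)) subn1 addn1 /=.
(* [r] and [k] are now one less than in the statement, so the last entry there is [k.+2]. *)
pose zk i := zeta R (rcons (nseq i 1%N) k.+2).
have asymz i : asym (@Lr R (k.+2 :: nseq i 1%N)) (zk i)%:P.
  have ii : is_index (nseq i 1%N) by rewrite /is_index all_nseq orbT.
  have [c Hc] := @asym_Lr_const R k _ ii; rewrite /zk (zeta_asym (c := c))//.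
  by rewrite rev_rcons rev_nseq.
have A1 : asym (fun z => \sum_(w <- idx r.+1 k.+1) @Lr R w z)
    (\sum_(w <- idx r.+1 k.+1) Zsh R (rev w)).
  apply: asym_sum => w; rewrite mem_idx => /and3P[_ iw _].
  by rewrite -{1}[w]revK; apply: Zsh_asym; rewrite /is_index all_rev.
(* By [Lr_ones] and [asymz], this is the expansion of the summand [i] in [sum_Lr_idx]. *)
pose Q (i : 'I_r.+1) : {poly R} :=
  ((-1) ^+ i)%:P * (((r - i)`!%:R^-1)%:P * 'X^(r - i) * (zk i)%:P).
have A2 : asym (fun z => \sum_(w <- idx r.+1 k.+1) @Lr R w z) (\sum_(i < r.+1) Q i).
  apply: (@asym_ext _ (fun z => \sum_(i < r.+1) (-1) ^+ i *
     (Lr (nseq (r - i) 1%N) z * Lr (k.+2 :: nseq i 1%N) z))).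
    by move=> z z01; rewrite sum_Lr_idx.
  apply: asym_sum => i _; apply: asymM; first exact: asym_cst.
  apply: asymM; last exact: asymz.
  apply: asym_ext (asym_horner _) => z z01.
  by rewrite Lr_ones// !hornerE mulrC.
under eq_bigr do rewrite /zeta_sh.
(* The two expansions coincide; at 0 only the summand [i = r], free of ['X], survives. *)
rewrite -horner_sum (asym_unique A1 A2) horner_sum big_ord_recr /= big1 ?add0r.
  by rewrite /Q subnn !hornerM !hornerC fact0 invr1 !mul1r.
move=> i _; rewrite /Q !hornerM !hornerC hornerXn expr0n subn_eq0 leqNgt (ltn_ord i).
by rewrite mulr0 mul0r mulr0.
Qed.
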